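(* Let $G$ be a locally compact group. If there exists a non-zero polynomial function in $C_c(G)$ for the action of $G$ on itself by right multiplication, then $G$ has a compact open subgroup.
   Context: Locally compact groups are Hausdorff. $C_c(G)$ is the space of continuous complex functions on $G$ with compact support. For $f\in C_c(G)$ and $q\in G$, let $(q\cdot f)(p)=f(pq)$. A function $f\in C_c(G)$ is polynomial (for right multiplication) if there are an open neighborhood $V$ of the identity in $G$ and a finite-dimensional subspace $F$ of $C_c(G)$ such that $v\cdot f\in F$ for all $v\in V$. *)

(* Defs.v *)
From HB Require Import structures.
From mathcomp Require Import all_boot all_order all_algebra.
From mathcomp Require Import complex.
From mathcomp Require Import all_classical all_reals all_analysis.
Set Implicit Arguments.
Unset Strict Implicit.
Unset Printing Implicit Defensive.
Import GRing.Theory Num.Theory.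
Import numFieldNormedType.Exports.
Local Open Scope classical_set_scope.
Local Open Scope ring_scope.

HB.mixin Record Group_isTopologicalGroup G of Group G & Topological G := {
  mulg_continuous : continuous (fun x : G * G => (x.1 * x.2)%g);
  invg_continuous : continuous (fun x : G => (x^-1)%g)
}.

#[short(type="topologicalGroupType")]
HB.structure Definition TopologicalGroup :=
  {G of Group_isTopologicalGroup G & Group G & Topological G}.

Definition finite_dim_subspace (K : fieldType) (V : lmodType K) (F : set V) :=
  GRing.submod_closed [in F] /\
  exists (n : nat) (e : 'I_n -> V), (forall i, F (e i)) /\
    forall u, F u -> exists a : 'I_n -> K, u = \sum_(i < n) a i *: e i.

(* [R[i]^o] is the field [R[i]] of complex numbers carrying its norm topology
   and its structure of vector space over itself. *)
Definition Cc (R : realType) (G : topologicalType) : set (G -> R[i]^o) :=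
  [set f | continuous f /\ compact (closure [set x | f x != 0])].
Arguments Cc R G : clear implicits.

Definition rtrans (T : Type) (G : topologicalGroupType) (q : G) (f : G -> T) :
  G -> T := fun p => f (p * q)%g.

Definition polynomial_function (R : realType) (G : topologicalGroupType)
    (f : G -> R[i]^o) :=
  Cc R G f /\
  exists (V : set G) (F : set (G -> R[i]^o)),
    [/\ open V, V 1%g, finite_dim_subspace F, F `<=` Cc R G &
        forall v, V v -> F (rtrans v f)].

(* Main.v *)
Require Import Defs.
From mathcomp Require Import all_boot all_order all_algebra complex.
From mathcomp Require Import all_classical all_reals all_analysis.
Set Implicit Arguments.
Unset Strict Implicit.
Unset Printing Implicit Defensive.
Local Open Scope classical_set_scope.
Local Open Scope ring_scope.

Import GRing.Theory.

(** Right translations act linearly on functions, and [f] generates a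
    finite-dimensional space under the translations from a neighborhood of 1.
    Shrinking the neighborhood shrinks the space spanned by these translates,
    so at some point its dimension is minimal; the resulting space [W] no
    longer depends on the neighborhood, and therefore every [a] close to 1 maps
    it into itself: for [b] close enough to 1 the translates of [f] by [b]
    already span [W], and their images by [a] are translates of [f] by [a * b],
    again in [W] ([stable_translates]).  The stabilizer [H] of [W] is a
    subgroup that is a neighborhood of 1, hence is open, hence closed.

    All functions in [W] vanish outside one compact set [K], the union of the
    supports of finitely many generators.  If [f p0 != 0] and [g] lies in [H],
    the translate of [f] by [g^-1] is in [W] and does not vanish at [p0 * g];
    so [p0 * g] is in [K].  Thus [H] is a closed subset of the compact set
    [p0^-1 * K] ([nbhs1_subgroup_compact_open]). *)

Section TopologicalGroup.
Variable G : topologicalGroupType.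
Implicit Types (U H K : set G) (g h p : G).

Lemma continuous_mulgl g : continuous (fun x : G => g * x)%g.
Proof.
move=> x; apply: (@continuous2_cvg _ _ _ _ _ _ _ _ (fun a b : G => a * b)%g).
- exact: (@mulg_continuous G (g, x)).
- exact: cvg_cst.
- exact: cvg_id.
Qed.

Lemma nbhs1_mulg U : nbhs (1%g : G) U ->
  exists2 U1, nbhs (1%g : G) U1 & forall a b, U1 a -> U1 b -> U (a * b)%g.
Proof.
move=> nU.
have := @mulg_continuous G (1, 1)%g U.
rewrite /= mulg1 => /(_ nU) [[A B] [/= nA nB] sAB].
exists (A `&` B); first exact: filterI.
by move=> a b [Aa _] [_ Bb]; apply: (sAB (a, b)).
Qed.

Lemma nbhs1_invg U : nbhs (1%g : G) U -> nbhs (1%g : G) [set g | U (g^-1)%g].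
Proof. by move=> nU; have := @invg_continuous G 1%g U; rewrite invg1; apply. Qed.

Section Subgroup.
Variable H : set G.
Hypothesis Hgroup : group_closed [in H].

Let H_mul g h : H g -> H h -> H (g * h)%g.
Proof.
move=> /mem_set Hg /mem_set Hh; apply/set_mem.
exact: (group_closedM Hgroup).
Qed.

Let H_inv g : H g -> H (g^-1)%g.
Proof. by move=> /mem_set Hg; apply/set_mem/(group_closedV Hgroup). Qed.

Hypothesis nbhs1H : nbhs (1%g : G) H.

Let near_coset g : nbhs g [set x | H (g^-1 * x)%g].
Proof. by have := @continuous_mulgl (g^-1)%g g H; rewrite mulVg; apply. Qed.

Lemma nbhs1_subgroup_open : open H.
Proof.
rewrite openE => g Hg; apply: filterS (near_coset g) => x /= Hx.
by rewrite -[x](mulVKg g); apply: H_mul.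
Qed.

(** The complement of a subgroup is a union of its left cosets. *)
Lemma nbhs1_subgroup_closed : closed H.
Proof.
move=> g /(_ _ (near_coset g))[x [Hx /= Hgx]].
rewrite -[g]invgK -[(g^-1)%g](mulgK x).
by apply: H_inv; apply: H_mul => //; apply: H_inv.
Qed.

Lemma nbhs1_subgroup_compact_open p K : compact K ->
    (forall g, H g -> K (p * g)%g) ->
  exists H' : groupClosed G, compact [set` H'] /\ open [set` H'].
Proof.
move=> cK HK.
pose I := isInvClosed.Build G [in H] (group_closedV Hgroup).
pose M1 := isMul1Closed.Build G [in H] Hgroup.1.
pose M := isMulClosed.Build G [in H] (group_closedM Hgroup).
pose H' : groupClosed G := GroupClosed.Pack (GroupClosed.Class I M1 M).
exists H'; have -> : [set` H'] = H by apply/seteqP; split=> x /=; rewrite inE.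
split; last exact: nbhs1_subgroup_open.
apply: (@subclosed_compact _ _ [set (p^-1 * x)%g | x in K]).
- exact: nbhs1_subgroup_closed.
- apply: continuous_compact => //.
  exact/continuous_subspaceT/continuous_mulgl.
- by move=> g /HK Kpg; exists (p * g)%g => //; rewrite mulKg.
Qed.

End Subgroup.
End TopologicalGroup.

(** A vector subspace given by an arbitrary predicate is turned into a subspace
    of the dimension theory: a subspace of maximal dimension among those
    contained in the predicate must exhaust it. *)
Lemma submod_closed_vspace (K : fieldType) (E : vectType K) (S : {pred E}) :
  GRing.submod_closed S -> exists Y : {vspace E}, Y =i S.
Proof.
move=> [S0 SP].
pose Q d := `[< exists2 Y : {vspace E}, {subset Y <= S} & \dim Y = d >].
have Q0 : exists d, Q d.
  exists 0%N; apply/asboolP; exists 0%VS; last exact: dimv0.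
  by move=> x; rewrite memv0 => /eqP->.
have Qle d : Q d -> (d <= \dim {:E})%N.
  by move=> /asboolP[Y _ <-]; rewrite dimvS ?subvf.
case: (ex_maxnP Q0 Qle) => d /asboolP[Y YS dY] dmax.
exists Y => x; apply/idP/idP=> [/YS //|Sx]; apply/negPn/negP => Yx.
have : Q (\dim (Y + <[x]>)).
  apply/asboolP; exists (Y + <[x]>)%VS => // y /memv_addP[u Yu [v]].
  by move=> /vlineP[k ->] ->; rewrite addrC; apply: SP => //; apply: YS.
move=> /dmax; rewrite -dY leqNgt => /negP; apply.
rewrite (ltn_leqif (dimv_leqif_sup (addvSl _ _))).
by rewrite subv_add subvv -memvE (negbTE Yx).
Qed.

Section Translates.
Variables (G : topologicalGroupType) (K : fieldType) (M : lmodType K).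
Implicit Types (f : G -> M) (g h : G).

Lemma rtransM g h f : rtrans (g * h)%g f = rtrans g (rtrans h f).
Proof. by apply/funext => p; rewrite /rtrans mulgA. Qed.

Lemma rtrans1 f : rtrans 1%g f = f.
Proof. by apply/funext => p; rewrite /rtrans mulg1. Qed.

Variables (n : nat) (e : 'I_n -> G -> M).

Let comb (x : 'rV[K]_n) : G -> M := fun p => \sum_i x 0 i *: e i p.

Let combP k x y : comb (k *: x + y) = fun p => k *: comb x p + comb y p.
Proof.
apply/funext => p; rewrite /comb scaler_sumr -big_split /=.
by apply: eq_bigr => i _; rewrite !mxE scalerDl scalerA.
Qed.

(** The space [W] is spanned by the translates of [f] from a neighborhood chosen
    so as to minimize its dimension.  The generators [e] need not be linearly
    independent, so dimensions are those of subspaces of coordinate vectors. *)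
Lemma stable_translates f (V : set G) : nbhs (1%g : G) V ->
    (forall v, V v -> exists a : 'I_n -> K,
       rtrans v f = fun p => \sum_i a i *: e i p) ->
  exists W : set (G -> M), [/\ W f,
    forall w, W w -> exists a : 'I_n -> K, w = fun p => \sum_i a i *: e i p &
    nbhs (1%g : G) [set g | forall w, W w -> W (rtrans g w)]].
Proof.
move=> nV VP.
pose spans (X : {vspace 'rV[K]_n}) (U : set G) :=
  forall v, U v -> exists2 x, x \in X & rtrans v f = comb x.
pose Q d := `[< exists2 X, \dim X = d & exists2 U, nbhs (1%g : G) U & spans X U >].
have Q0 : exists d, Q d.
  exists (\dim (fullv : {vspace 'rV[K]_n})); apply/asboolP; exists fullv => //.
  exists V => // v /VP[a ->]; exists (\row_i a i); first exact: memvf.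
  by apply/funext => p; apply: eq_bigr => i _; rewrite mxE.
case: (ex_minnP Q0) => d /asboolP[X dX [U nU XU]] dmin.
exists [set comb x | x in [set` X]]; split.
- have [x Xx fx] := XU _ (nbhs_singleton nU).
  by exists x => //; rewrite -fx rtrans1.
- by move=> _ [x _ <-]; exists (x 0).
have [U1 nU1 U1U] := nbhs1_mulg nU.
apply: filterS (nU1) => a U1a _ [x /= Xx <-].
(* The vectors of X that a keeps in the span of X; they suffice for the
   translates from U1, so minimality makes them all of X. *)
pose S := [pred y | (y \in X) && `[< exists2 z, z \in X & rtrans a (comb y) = comb z >]].
have SM : GRing.submod_closed S.
  split=> [|k y z].
    rewrite inE mem0v; apply/asboolP; exists 0; first exact: mem0v.
    by apply/funext => p; rewrite /rtrans /comb !big1 // => i _; rewrite mxE scale0r.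
  rewrite !inE => /andP[Xy /asboolP[y' Xy' yy']] /andP[Xz /asboolP[z' Xz' zz']].
  rewrite memvD ?memvZ //=; apply/asboolP; exists (k *: y' + z').
    by rewrite memvD ?memvZ.
  by rewrite !combP -yy' -zz'.
have [Y YS] := submod_closed_vspace SM.
have YX : (Y <= X)%VS by apply/subvP => y; rewrite YS inE => /andP[].
have : Q (\dim Y).
  apply/asboolP; exists Y => //; exists U1 => // b U1b.
  have [y Xy fy] := XU _ (U1U 1%g b (nbhs_singleton nU1) U1b).
  rewrite mul1g in fy; exists y => //; rewrite YS inE Xy /=; apply/asboolP.
  by rewrite -fy -rtransM; apply: XU; apply: U1U.
move=> /dmin; rewrite -dX => dXY.
have XY : X = Y by apply/esym/eqP; rewrite eqEdim YX.
move: Xx; rewrite XY YS inE => /andP[_ /asboolP[z Xz ->]].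
by exists z => //=; rewrite -XY.
Qed.

End Translates.

Theorem corollary3p19 (R : realType) (G : topologicalGroupType)
    (hG : hausdorff_space G) (lcG : locally_compact [set: G]) :
  (exists2 f : G -> R[i]^o, polynomial_function f & f != 0) ->
  exists H : groupClosed G, compact [set` H] /\ open [set` H].
Proof.
move=> [f [_ [V [F [oV V1 [_ [n [e [Fe FP]]]] FC FV]]]] f0].
have nV : nbhs (1%g : G) V by apply: open_nbhs_nbhs.
have [|W [Wf WP Wstab]] := @stable_translates G _ _ n e f V nV.
  move=> v /FV/FP[a ->]; exists a; apply/funext => p.
  by rewrite fct_sumE.
have [p0 fp0] : exists p, f p != 0.
  apply: contrapT => f_eq0; case/eqP: f0; apply/funext => p.
  by apply/eqP/negPn/negP => fp; apply: f_eq0; exists p.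
pose N := [set g | forall w, W w -> W (rtrans g w)].
pose H := N `&` [set g | N (g^-1)%g].
have NM g h : N g -> N h -> N (g * h)%g.
  by move=> Ng Nh w Ww; rewrite rtransM; apply/Ng/Nh.
have Hgroup : group_closed [in H].
  split=> [|g h]; rewrite !inE /H /=.
    by rewrite invg1; split=> w; rewrite rtrans1.
  by move=> [Ng Ng'] [Nh Nh']; rewrite invgF; split; apply: NM.
pose K := \big[setU/set0]_(i < n) closure [set x | e i x != 0].
apply: (@nbhs1_subgroup_compact_open G H Hgroup _ p0 K).
- exact: filterI (nbhs1_invg Wstab).
- by apply: bigsetU_compact => i _; case: (FC _ (Fe i)).
move=> g [_ /(_ _ Wf)/WP[a /(congr1 (@^~ (p0 * g)%g))]].
rewrite /rtrans mulgK => fE.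
have [i eig] : exists i, e i (p0 * g)%g != 0.
  apply: contrapT => e_eq0; case/eqP: fp0; rewrite fE big1 // => i _.
  have [->|ei] := eqVneq (e i (p0 * g)%g) 0; first by rewrite scaler0.
  by case: e_eq0; exists i.
by rewrite /K (bigD1 i) //; left; apply: subset_closure.
Qed.
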